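(* Let $A\in\mathbb{R}^{n\times n}$, $B\in\mathbb{R}^{n\times m}$, $C\in\mathbb{R}^{p\times n}$ be such that $(A,B)$ is stabilizable and $(A,C)$ is observable, and let $L\in\mathbb{R}^{n\times p}$ be such that $\Lambda(s)=\det(sI-A+LC)$ is Hurwitz. Let $A_\zeta$, $B_\zeta$ be the matrices associated with $(A,B,C,L)$ as defined in the context. Then the pair $(A_\zeta,B_\zeta)$ is stabilizable.
   Context: Let $\Lambda(s)=\det(sI-A+LC)=s^n+\alpha_{n-1}s^{n-1}+\cdots+\alpha_1 s+\alpha_0$ (Hurwitz means that all its roots have negative real part), and let $D_0,\dots,D_{n-1}\in\mathbb{R}^{n\times n}$ be the constant matrices with $(sI-A+LC)^{-1}=\frac{1}{\Lambda(s)}\sum_{j=0}^{n-1}D_js^j$. For $i=1,\dots,m$ let $f_i$ be the $i$-th column of $B$, and for $i=m+1,\dots,m+p$ let $f_i$ be the $(i-m)$-th column of $L$. Set $M_i=[D_0f_i,\dots,D_{n-1}f_i]\in\mathbb{R}^{n\times n}$ and $M=[M_1,\dots,M_{m+p}]\in\mathbb{R}^{n\times(m+p)n}$. Let $\mathcal{A}\in\mathbb{R}^{n\times n}$ be the companion matrix with ones on the first superdiagonal, last row $(-\alpha_0,-\alpha_1,\dots,-\alpha_{n-1})$ and zeros elsewhere, and $b=(0,\dots,0,1)^T\in\mathbb{R}^n$. With $\otimes$ the Kronecker product and $\mathbf{0}$ zero blocks of compatible size, $$A_\zeta=(I_{m+p}\otimes\mathcal{A})+\begin{bmatrix}\mathbf{0}\\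 I_p\otimes b\end{bmatrix}CM,\qquad B_\zeta=\begin{bmatrix}I_m\otimes b\\ \mathbf{0}\end{bmatrix},$$ so $A_\zeta$ is $(m+p)n\times(m+p)n$ and $B_\zeta$ is $(m+p)n\times m$. *)

(* Defs.v *)
From HB Require Import structures.
From mathcomp Require Import all_boot all_order all_algebra.
From mathcomp Require Import reals.
From mathcomp Require Import mxtens complex.

Set Implicit Arguments.
Unset Strict Implicit.
Unset Printing Implicit Defensive.

Import Order.TTheory GRing.Theory Num.Theory.
Local Open Scope ring_scope.
Local Open Scope complex_scope.

Section LinearSystems.
Variable R : realType.

Definition hurwitz (q : {poly R}) : Prop :=
  forall z : R[i], root (map_poly (real_complex R) q) z -> complex.Re z < 0.

Definition stabilizable n m (A : 'M[R]_n) (B : 'M[R]_(n, m)) : Prop :=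
  exists K : 'M[R]_(m, n), hurwitz (char_poly (A + B *m K)).

(* The Kalman matrix [C; C A; ...; C A^(n-1)]. *)
Definition observability_mx n p (A : 'M[R]_n) (C : 'M[R]_(p, n)) :=
  \mxcol_(k < n) (C *m A ^+ k).

Definition observable n p (A : 'M[R]_n) (C : 'M[R]_(p, n)) : Prop :=
  \rank (observability_mx A C) = n.

(* [char_poly F] is det(sI - F), so this is det(sI - A + LC). *)
Definition Lambda n p (A : 'M[R]_n) (C : 'M[R]_(p, n)) (L : 'M[R]_(n, p)) :
  {poly R} := char_poly (A - L *m C).

(* (sI - A + LC)^-1 = Lambda(s)^-1 * \sum_j D_j s^j.  The entries of
   Lambda(s) (sI - A + LC)^-1 are polynomials in s, so requiring this at the
   real s with Lambda(s) != 0 determines D and is the identity of rational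
   matrices; D_j is the matrix of s^j-coefficients of \adj(sI - A + LC). *)
Definition resolvent_coeffs n p (A : 'M[R]_n) (C : 'M[R]_(p, n))
    (L : 'M[R]_(n, p)) (D : 'I_n -> 'M[R]_n) : Prop :=
  forall s : R, (Lambda A C L).[s] != 0 ->
    invmx (s%:M - A + L *m C) =
    (Lambda A C L).[s]^-1 *: \sum_(j < n) s ^+ j *: D j.

(* The columns of B followed by those of L. *)
Definition fvec n m p (B : 'M[R]_(n, m)) (L : 'M[R]_(n, p))
  (i : 'I_(m + p)) : 'cV[R]_n := col i (row_mx B L).

Definition Mblock n m p (B : 'M[R]_(n, m)) (L : 'M[R]_(n, p))
    (D : 'I_n -> 'M[R]_n) (i : 'I_(m + p)) : 'M[R]_n :=
  \matrix_(r, j) (D j *m fvec B L i) r 0.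

(* Column i * n + j of M is column j of the i-th block; [mxtens_unindex] is the
   indexing used by the Kronecker product [*t], so blocks match I *t _. *)
Definition Mmx n m p (B : 'M[R]_(n, m)) (L : 'M[R]_(n, p))
    (D : 'I_n -> 'M[R]_n) : 'M[R]_(n, (m + p) * n) :=
  \matrix_(r, k) Mblock B L D (mxtens_unindex k).1 r (mxtens_unindex k).2.

(* [companionmx] from mxpoly has the same entries, but its dimension is
   (size q).-1, which is only propositionally equal to n. *)
Definition companion n (q : {poly R}) : 'M[R]_n :=
  \matrix_(i, j) if i.+1 == n then - q`_j else (i.+1 == j)%:R.

Definition bvec n : 'cV[R]_n := \col_i (i.+1 == n)%:R.

(* The casts below only identify m * n + p * n with (m + p) * n and p * 1
   (resp. m * 1) with p (resp. m). *)
Definition out_inj n m p : 'M[R]_((m + p) * n, p) :=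
  castmx (esym (mulnDl m p n), muln1 p)
    (col_mx (0 : 'M[R]_(m * n, p * 1)) ((1%:M : 'M[R]_p) *t bvec n)).

Definition A_zeta n m p (A : 'M[R]_n) (B : 'M[R]_(n, m)) (C : 'M[R]_(p, n))
    (L : 'M[R]_(n, p)) (D : 'I_n -> 'M[R]_n) : 'M[R]_((m + p) * n) :=
  (1%:M : 'M[R]_(m + p)) *t companion n (Lambda A C L)
  + out_inj n m p *m C *m Mmx B L D.

Definition B_zeta n m p : 'M[R]_((m + p) * n, m) :=
  castmx (esym (mulnDl m p n), muln1 m)
    (col_mx ((1%:M : 'M[R]_m) *t bvec n) (0 : 'M[R]_(p * n, m * 1))).

End LinearSystems.

Arguments B_zeta R n m p : clear implicits.

(* Main.v *)
Require Import Defs.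
From mathcomp Require Import all_boot all_order all_algebra.
From mathcomp Require Import reals.
From mathcomp Require Import mxtens complex.

Set Implicit Arguments.
Unset Strict Implicit.
Unset Printing Implicit Defensive.

Import Order.TTheory GRing.Theory Num.Theory.
Local Open Scope ring_scope.

(** The matrix M intertwines the big system with the original one.  Write
    F = A - L C.  Comparing the coefficients of s^k in
    (sI - F) (\sum_j D_j s^j) = Lambda(s) I gives D_(n-1) = I and
    D_(k-1) = F D_k + alpha_k I (with D_(-1) = 0); this says exactly that right
    multiplication of [D_0 f, ..., D_(n-1) f] by the companion matrix is left
    multiplication by F, and that this block sends b to f
    ([companion_resolvent], [resolvent_last]).  Hence M (I (x) companion) = F M,
    while M sends the two injections of A_zeta and B_zeta to L and B, so that
    M A_zeta = A M and M B_zeta = B.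

    Let K be a gain that makes A + B K Hurwitz, and feed back with K M.  The
    closed loop G = A_zeta + B_zeta K M has the form (I (x) companion) + U M and
    satisfies M G = (A + B K) M.  Take an eigenvector v of G.  If M v <> 0, then
    M v is an eigenvector of A + B K for the same eigenvalue; if M v = 0, then
    G v = (I (x) companion) v and the eigenvalue is a root of Lambda.  In both
    cases its real part is negative ([root_char_poly_intertwined]). *)

(** * Identifying polynomial coefficients from values *)

Lemma poly_eq0_off_roots (R : numDomainType) (p q : {poly R}) :
  q != 0 -> (forall s, q.[s] != 0 -> p.[s] = 0) -> p = 0.
Proof.
move=> q_neq0 p0; suff /eqP : p * q = 0.
  by rewrite mulf_eq0 (negPf q_neq0) orbF => /eqP.
pose rs : seq R := [seq i%:R | i <- iota 0 (size (p * q))].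
apply: (@roots_geq_poly_eq0 _ _ rs).
- apply/allP => x _; rewrite /root hornerM mulf_eq0.
  by have [//|/p0->] := eqVneq q.[x] 0; rewrite ?orbT // eqxx.
- by rewrite map_inj_uniq ?iota_uniq // => i j /eqP; rewrite eqr_nat => /eqP.
- by rewrite size_map size_iota.
Qed.

(** Passes from the resolvent identity, known only for the s that are not roots
    of q, to an identity for each coefficient.  Writing the shifted family as
    a sum over [j.+1 == k] avoids predecessors of ordinals and covers the two
    boundary coefficients k = 0 and k = n uniformly. *)
Lemma eq_coef_off_roots (R : numDomainType) n (q : {poly R})
    (E G : 'I_n -> 'M[R]_n) :
  q != 0 ->
  (forall s, q.[s] != 0 ->
     \sum_(j < n) s ^+ j.+1 *: E j - \sum_(j < n) s ^+ j *: G j = q.[s]%:M) ->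
  forall k, \sum_(j < n) (j.+1 == k)%:R *: E j
    - \sum_(j < n) (val j == k)%:R *: G j = (q`_k)%:M.
Proof.
move=> q_neq0 EGq k; apply/matrixP => r c.
pose d := \sum_(j < n) E j r c *: 'X^(j.+1) - \sum_(j < n) G j r c *: 'X^j
  - q *+ (r == c).
have d0 : d = 0.
  apply: (poly_eq0_off_roots q_neq0) => s qs.
  have /matrixP/(_ r c)/eqP := EGq s qs.
  rewrite !mxE -subr_eq0 !summxE => /eqP eq0; rewrite -[RHS]eq0.
  rewrite /d !hornerD !hornerN hornerMn !horner_sum.
  by congr (_ - _ - _); apply: eq_bigr => j _;
    rewrite [in RHS]mxE hornerZ hornerXn mulrC.
have /eqP := congr1 (fun d : {poly R} => d`_k) d0.
rewrite /d coef0 !coefB coefMn !coef_sum subr_eq0 !mxE !summxE => /eqP <-.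
by congr (_ - _); apply: eq_bigr => j _;
  rewrite [in LHS]mxE coefZ coefXn mulrC eq_sym.
Qed.

(** * Eigenvectors *)

Lemma char_poly_tr (R : comNzRingType) n (A : 'M[R]_n) :
  char_poly A^T = char_poly A.
Proof.
rewrite /char_poly -[RHS]det_tr; congr (\det _).
by rewrite /char_poly_mx linearB /= tr_scalar_mx map_trmx.
Qed.

Lemma root_char_poly_colP (F : fieldType) n (A : 'M[F]_n) z :
  reflect (exists2 v : 'cV_n, A *m v = z *: v & v != 0) (root (char_poly A) z).
Proof.
rewrite -char_poly_tr -eigenvalue_root_char.
apply: (iffP eigenvalueP) => -[v eigv v_neq0]; exists v^T.
- by rewrite -[A]trmxK -trmx_mul eigv linearZ.
- by rewrite trmx_eq0.
- by rewrite -trmx_mul eigv linearZ.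
- by rewrite trmx_eq0.
Qed.

(** An eigenvector of [G + U *m M] is either mapped by M to an eigenvector of H
    or killed by M, and then it is an eigenvector of G. *)
Lemma root_char_poly_intertwined (F : fieldType) N n (G : 'M[F]_N)
    (U : 'M_(N, n)) (M : 'M_(n, N)) (H : 'M_n) z :
  M *m (G + U *m M) = H *m M -> root (char_poly (G + U *m M)) z ->
  root (char_poly H) z || root (char_poly G) z.
Proof.
move=> MH /root_char_poly_colP[v eigv v_neq0].
have [Mv0|Mv_neq0] := eqVneq (M *m v) 0; apply/orP; [right|left];
  apply/root_char_poly_colP.
- by exists v => //; rewrite -eigv mulmxDl -mulmxA Mv0 mulmx0 addr0.
- by exists (M *m v); rewrite // mulmxA -MH -mulmxA eigv -scalemxAr.
Qed.

(** * Kronecker products *)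

Lemma sum_mxtens (V : nmodType) m n (f : 'I_(m * n) -> V) :
  \sum_k f k = \sum_i \sum_j f (mxtens_index (i, j)).
Proof.
rewrite pair_bigA (reindex (@mxtens_index m n)).
  by apply: eq_bigr => -[].
by exists (@mxtens_unindex m n) => k _;
  rewrite (mxtens_indexK, mxtens_unindexK).
Qed.

(** [tens_col_mx] for an upper block with any number of rows. *)
Lemma tens_col_mx_cast (R : pzRingType) m p q n r (X : 'M[R]_(m, q))
    (Y : 'M[R]_(p, q)) (N : 'M[R]_(n, r)) :
  castmx (esym (mulnDl m p n), erefl) (col_mx (X *t N) (Y *t N)) =
  col_mx X Y *t N.
Proof.
apply/matrixP => k c; rewrite castmxE /= cast_ord_id esymK.
case: (mxtens_indexP k) => i j; case: (mxtens_indexP c) => c0 d; rewrite tensmxE.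
rewrite -(splitK i); case: (split i) => i' /=.
  rewrite col_mxEu.
  have -> : cast_ord (mulnDl m p n) (mxtens_index (lshift p i', j)) =
    lshift (p * n) (mxtens_index (i', j)) by apply: val_inj.
  by rewrite col_mxEu tensmxE.
rewrite col_mxEd.
have -> : cast_ord (mulnDl m p n) (mxtens_index (rshift m i', j)) =
    rshift (m * n) (mxtens_index (i', j)).
  by apply: val_inj; rewrite /= mulnDl addnA.
by rewrite col_mxEd tensmxE.
Qed.

(** The blocks of an eigenvector of the block-diagonal matrix are eigenvectors
    of A or zero, and one of them is not zero. *)
Lemma root_char_poly_tens1mx (F : fieldType) q n (A : 'M[F]_n) z :
  root (char_poly ((1%:M : 'M_q) *t A)) z -> root (char_poly A) z.
Proof.
case/root_char_poly_colP=> v eigv /cV0Pn[k vk_neq0].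
case: (mxtens_indexP k) vk_neq0 => i j vij_neq0; apply/root_char_poly_colP.
exists (\col_k v (mxtens_index (i, k)) 0); last first.
  by apply/cV0Pn; exists j; rewrite mxE.
apply/colP=> l; have /colP/(_ (mxtens_index (i, l))) := eigv.
rewrite !mxE sum_mxtens => <-.
rewrite (bigD1 i) //= [X in _ + X]big1 ?addr0 => [|a /negPf ai].
  by apply: eq_bigr => b _; rewrite tensmxE !mxE eqxx mul1r.
by apply: big1 => b _; rewrite tensmxE !mxE eq_sym ai !mul0r.
Qed.

(** * Hurwitz characteristic polynomials *)

Section Hurwitz.
Variable R : realType.

Lemma hurwitz_intertwined N n (G : 'M[R]_N) (U : 'M_(N, n)) (M : 'M_(n, N))
    (H : 'M_n) :
  M *m (G + U *m M) = H *m M ->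
  hurwitz (char_poly H) -> hurwitz (char_poly G) ->
  hurwitz (char_poly (G + U *m M)).
Proof.
move=> MH hurH hurG z; rewrite map_char_poly map_mxD map_mxM => /=.
have /= := congr1 (map_mx (real_complex R)) MH.
rewrite !map_mxM map_mxD map_mxM /= => MH'.
move=> /(root_char_poly_intertwined MH')/orP[|] rz.
  by apply: hurH; rewrite map_char_poly.
by apply: hurG; rewrite map_char_poly.
Qed.

Lemma hurwitz_tens1mx q n (A : 'M[R]_n) :
  hurwitz (char_poly A) -> hurwitz (char_poly ((1%:M : 'M_q) *t A)).
Proof.
move=> hurA z; rewrite map_char_poly map_mxT map_mx1.
by move/root_char_poly_tens1mx => rz; apply: hurA; rewrite map_char_poly.
Qed.

Lemma char_poly_companion n (q : {poly R}) :
  q \is monic -> size q = n.+1 -> char_poly (companion n q) = q.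
Proof.
move=> q_monic sz_q; rewrite -[RHS]companionmxK //.
have -> : n = (size q).-1 by rewrite sz_q.
congr char_poly; apply/matrixP => i j; rewrite !mxE.
by case: (size q).-1 i j => [|d] [].
Qed.

End Hurwitz.

(** * The intertwining matrix M *)

Section Intertwining.
Variables (R : realType) (n m p : nat).
Variables (A : 'M[R]_n) (B : 'M[R]_(n, m)) (C : 'M[R]_(p, n)) (L : 'M[R]_(n, p)).
Variable D : 'I_n -> 'M[R]_n.
Hypothesis resolventD : resolvent_coeffs A C L D.

Lemma Lambda_monic : Lambda A C L \is monic.
Proof. exact: char_poly_monic. Qed.

Lemma size_Lambda : size (Lambda A C L) = n.+1.
Proof. exact: size_char_poly. Qed.

Lemma resolvent_mulmx s : (Lambda A C L).[s] != 0 ->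
  \sum_(j < n) s ^+ j.+1 *: D j - \sum_(j < n) s ^+ j *: ((A - L *m C) *m D j)
  = (Lambda A C L).[s]%:M.
Proof.
move=> Ls; have := resolventD Ls.
have -> : s%:M - A + L *m C = s%:M - (A - L *m C).
  by rewrite opprD opprK addrA.
move/(congr1 (fun X => (s%:M - (A - L *m C)) *m X)).
rewrite mulmxV; last first.
  rewrite unitmxE unitfE; apply: contraNneq Ls => det0.
  apply/eqP; rewrite -[RHS]det0 /Lambda /char_poly -horner_evalE -det_map_mx.
  congr (\det _); apply/matrixP => i j.
  by rewrite !mxE /= /horner_eval !hornerE hornerMn hornerX.
rewrite -scalemxAr => /(congr1 (fun X => (Lambda A C L).[s] *: X)).
rewrite scalerA mulfV // scale1r scalemx1 => ->.
rewrite mulmxBl mul_scalar_mx scaler_sumr mulmx_sumr.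
by congr (_ - _); apply: eq_bigr => j _; rewrite ?scalerA ?exprS // scalemxAr.
Qed.

(** The coefficient of s^k in (sI - F) (\sum_j D_j s^j) = Lambda(s) I. *)
Lemma resolvent_recurrence k :
  \sum_(j < n) (j.+1 == k)%:R *: D j
  - \sum_(j < n) (val j == k)%:R *: ((A - L *m C) *m D j)
  = ((Lambda A C L)`_k)%:M.
Proof. exact: (eq_coef_off_roots (monic_neq0 Lambda_monic) resolvent_mulmx). Qed.

Lemma resolvent_last : \sum_(j < n) (j.+1 == n)%:R *: D j = 1%:M.
Proof.
have := resolvent_recurrence n.
rewrite [X in _ - X]big1 => [|j _]; last first.
  by rewrite (ltn_eqF (ltn_ord j)) scale0r.
move/monicP: Lambda_monic; rewrite lead_coefE size_Lambda /= => ->.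
by rewrite subr0.
Qed.

(** Column j of the companion matrix has a 1 just above the diagonal and
    - alpha_j in its last row, so the sum is D_(j-1) - alpha_j D_(n-1); this is
    F D_j by the recurrence, since D_(n-1) = I. *)
Lemma companion_resolvent (j : 'I_n) :
  \sum_(i < n) companion n (Lambda A C L) i j *: D i = (A - L *m C) *m D j.
Proof.
have := resolvent_recurrence j.
rewrite [X in _ - X](bigD1 j) //= eqxx scale1r.
rewrite [X in _ - (_ + X)]big1 ?addr0; last first.
  by move=> i /negPf ij; rewrite -[_ == _]/(i == j) ij scale0r.
move/eqP; rewrite subr_eq addrC -subr_eq => /eqP <-.
rewrite -scalemx1 -resolvent_last scaler_sumr -sumrB; apply: eq_bigr => i _.
rewrite mxE scalerA -scalerBl; congr (_ *: _).
(* The superdiagonal entry is absent from the last row, as j < n. *)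
case: eqP => [->|_]; last by rewrite mulr0 subr0.
by rewrite gtn_eqF // mulr1 sub0r.
Qed.

Lemma MmxE r i j : Mmx B L D r (mxtens_index (i, j)) = (D j *m row_mx B L) r i.
Proof.
rewrite mxE mxtens_indexK mxE /= /fvec !mxE.
by apply: eq_bigr => k _; rewrite mxE.
Qed.

Lemma Mmx_mul_tens q t (X : 'M[R]_(m + p, q)) (Y : 'M[R]_(n, t)) r c d :
  (Mmx B L D *m (X *t Y)) r (mxtens_index (c, d)) =
  ((\sum_(j < n) Y j d *: D j) *m (row_mx B L *m X)) r c.
Proof.
rewrite mxE sum_mxtens mulmxA [in RHS]mxE; apply: eq_bigr => i _.
rewrite mulmx_suml summxE mulr_suml; apply: eq_bigr => j _.
by rewrite MmxE tensmxE -scalemxAl [in RHS]mxE mulrA mulrC mulrA.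
Qed.

Lemma Mmx_companion :
  Mmx B L D *m ((1%:M : 'M_(m + p)) *t companion n (Lambda A C L)) =
  (A - L *m C) *m Mmx B L D.
Proof.
apply/matrixP => r k; case: (mxtens_indexP k) => i j.
rewrite Mmx_mul_tens companion_resolvent mulmx1 -mulmxA [LHS]mxE [RHS]mxE.
by apply: eq_bigr => a _; rewrite MmxE.
Qed.

(** The vector b selects the last column of each block of M, which is
    D_(n-1) f_i = f_i; the f_i are the columns of [row_mx B L]. *)
Lemma Mmx_bvec q (X : 'M[R]_(m + p, q)) :
  Mmx B L D *m castmx (erefl, muln1 q) (X *t bvec R n) = row_mx B L *m X.
Proof.
rewrite -[Mmx B L D in LHS](castmx_id (erefl n, erefl)) -castmx_mul.
apply/matrixP => r c; rewrite castmxE /= cast_ord_id.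
have -> : cast_ord (esym (muln1 q)) c = mxtens_index (c, 0).
  by apply: val_inj; rewrite /= muln1 addn0.
rewrite Mmx_mul_tens.
under eq_bigr => j _ do rewrite mxE.
by rewrite resolvent_last mul1mx.
Qed.

Lemma Mmx_out_inj : Mmx B L D *m out_inj R n m p = L.
Proof.
have -> : out_inj R n m p = castmx (erefl, muln1 p)
    (col_mx (0 : 'M[R]_(m, p)) 1%:M *t bvec R n).
  rewrite -tens_col_mx_cast tens0mx castmx_comp.
  by congr castmx; congr pair; apply: eq_irrelevance.
by rewrite Mmx_bvec mul_row_col mulmx0 add0r mulmx1.
Qed.

Lemma Mmx_B_zeta : Mmx B L D *m B_zeta R n m p = B.
Proof.
have -> : B_zeta R n m p = castmx (erefl, muln1 m)
    (col_mx 1%:M (0 : 'M[R]_(p, m)) *t bvec R n).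
  rewrite -tens_col_mx_cast tens0mx castmx_comp.
  by congr castmx; congr pair; apply: eq_irrelevance.
by rewrite Mmx_bvec mul_row_col mulmx0 addr0 mulmx1.
Qed.

End Intertwining.

Theorem lemma6 (R : realType) (n m p : nat)
    (A : 'M[R]_n) (B : 'M[R]_(n, m)) (C : 'M[R]_(p, n)) (L : 'M[R]_(n, p))
    (D : 'I_n -> 'M[R]_n)
    (stabAB : stabilizable A B)
    (obsAC : observable A C)
    (hurwitzL : hurwitz (Lambda A C L))
    (resolventD : resolvent_coeffs A C L D) :
  stabilizable (A_zeta A B C L D) (B_zeta R n m p).
Proof.
have [K hurK] := stabAB; exists (K *m Mmx B L D).
have MU : Mmx B L D *m (out_inj R n m p *m C + B_zeta R n m p *m K)
    = L *m C + B *m K.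
  rewrite mulmxDr !mulmxA.
  by rewrite (Mmx_out_inj _ resolventD) (Mmx_B_zeta _ resolventD).
rewrite /A_zeta -addrA mulmxA -mulmxDl.
apply: (hurwitz_intertwined (H := A + B *m K)) => //.
- by rewrite mulmxDr Mmx_companion // mulmxA MU -mulmxDl addrA subrK.
- apply: hurwitz_tens1mx; rewrite char_poly_companion //.
  + exact: Lambda_monic.
  + exact: size_Lambda.
Qed.
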